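(* Let $H$ be a complex Hilbert space and let $k$ be an integer with $\dim H>2k>2$ ($H$ may be infinite-dimensional). Let $f:{\mathcal G}_{k}(H)\to{\mathcal G}_{k}(H)$ be an orthogonality preserving transformation which satisfies one of the following additional conditions: (A) $f$ is adjacency preserving; (OA) $f$ is injective and ortho-adjacency preserving. Then $f$ is induced by a linear or conjugate-linear isometry on $H$, i.e. there is a linear or conjugate-linear isometry $L:H\to H$ such that $f(X)=L(X)$ for every $X\in{\mathcal G}_{k}(H)$.
   Context: ${\mathcal G}_{k}(H)$ is the set of all $k$-dimensional subspaces of $H$. A transformation of a set is a (not necessarily injective or surjective) mapping of that set to itself. For a relation $R$ on a set, a transformation $f$ is $R$ preserving if $xRy$ implies $f(x)Rf(y)$ for all $x,y$. Two elements $X,Y\in{\mathcal G}_{k}(H)$ are orthogonal if every vector of $X$ is orthogonal to every vector of $Y$. They are adjacent if $\dim(X\cap Y)=k-1$ (equivalently, exactly one of the $k$ principal angles between them is non-zero). Two adjacent elements are ortho-adjacent if the unique non-zero principal angle between them equals $\pi/2$, i.e. $X\cap (X\cap Y)^{\perp}$ and $Y\cap(X\cap Y)^{\perp}$ are orthogonal lines. An isometry on $H$ is a norm-preserving linear or conjugate-linear map $H\to H$, not necessarily surjective. *)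

(* Defs.v *)
From HB Require Import structures.
From mathcomp Require Import all_boot all_order all_algebra.
From mathcomp Require Import complex.
From mathcomp Require Import boolp classical_sets reals topology normedtype.

Set Implicit Arguments.
Unset Strict Implicit.
Unset Printing Implicit Defensive.

Import Order.TTheory GRing.Theory Num.Theory.
Import numFieldNormedType.Exports.
Local Open Scope classical_set_scope.
Local Open Scope ring_scope.

Section LinearAlgebra.
Context {F : fieldType} {V : lmodType F}.

Definition lin_indep n (v : 'I_n -> V) : Prop :=
  forall a : 'I_n -> F, \sum_(i < n) a i *: v i = 0 -> forall i, a i = 0.

Definition lspan n (v : 'I_n -> V) : set V :=
  [set x | exists a : 'I_n -> F, x = \sum_(i < n) a i *: v i].

(* Such a set is automatically a linear subspace. *)
Definition has_dim (n : nat) (X : set V) : Prop :=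
  exists2 v : 'I_n -> V, lin_indep v & X = lspan v.

(* The dimension of V, possibly infinite, is larger than n. *)
Definition dim_gt (n : nat) : Prop :=
  exists v : 'I_n.+1 -> V, lin_indep v.

(* The set of all k-dimensional subspaces of V. By proof irrelevance two
   elements are equal as soon as the underlying sets are. *)
Record grassmannian (k : nat) := Grassmannian {
  gr_set :> set V;
  gr_dim : has_dim k gr_set
}.

Definition adjacent k (X Y : grassmannian k) : Prop := has_dim k.-1 (X `&` Y).

End LinearAlgebra.

Arguments dim_gt {F} V n.
Arguments grassmannian {F} V k.

(* The type of the norm of a normed module over C is C itself, with values
   in the nonnegative reals. *)
Definition inner_product_norm (C : numClosedFieldType) (H : normedModType C)
    (dot : {dot H for Num.conj}) : Prop :=
  forall x : H, `|x| ^+ 2 = dot x x.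

Section Orthogonality.
Context {C : numClosedFieldType} {H : lmodType C}.
Variable dot : {dot H for Num.conj}.

Definition orthogonal_sets (X Y : set H) : Prop :=
  forall x y, X x -> Y y -> dot x y = 0.

Definition ortho_compl (X : set H) : set H :=
  [set y | forall x, X x -> dot y x = 0].

Definition gr_orthogonal k (X Y : grassmannian H k) : Prop :=
  orthogonal_sets X Y.

Definition ortho_adjacent k (X Y : grassmannian H k) : Prop :=
  let X' := (X : set H) `&` ortho_compl (X `&` Y) in
  let Y' := (Y : set H) `&` ortho_compl (X `&` Y) in
  [/\ adjacent X Y, has_dim 1 X', has_dim 1 Y' & orthogonal_sets X' Y'].

End Orthogonality.

Definition conj_linear (C : numClosedFieldType) (U V : lmodType C)
    (L : U -> V) : Prop :=
  GRing.linear_for (Num.conj \; *:%R) L.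

Definition is_isometry (C : numClosedFieldType) (H : normedModType C)
    (L : H -> H) : Prop :=
  (linear L \/ conj_linear L) /\ forall x, `|L x| = `|x|.

(* Main.v *)
Require Import Defs.
From HB Require Import structures.
From mathcomp Require Import all_boot all_order all_algebra.
From mathcomp Require Import complex.
From mathcomp Require Import boolp classical_sets reals topology normedtype.
From mathcomp Require Import zify lra.

(** The proof lowers the dimension one step at a time until only the action on
    lines is left, and then applies an argument of Wigner type to the lines.

    Lowering the dimension. Let F act on the (n+1)-dimensional subspaces, fix a
    subspace S of dimension n, and let p, q, r be orthogonal unit vectors
    orthogonal to S. The images of S+p, S+q, S+r pairwise meet in codimension
    at most one, so they either contain a common n-dimensional subspace or lie
    in a common (n+2)-dimensional one. Orthogonality rules out the second case.
    As dim H > 2(n+1), there is Z of dimension n+1 that contains r and is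
    orthogonal to S+p and S+q, so F Z is orthogonal to the images of both. On
    the other hand Z arises from S+r by n exchanges of one basis vector, each of
    which costs at most one dimension of the intersection of the images, so F Z
    meets F (S+r) ([star_normal]). A vector in this intersection is normal to
    the common n-dimensional subspace. Therefore all F X with X containing S
    share an n-dimensional subspace ([star_center]), which is the value at S of
    a new map, the [descent] of F.

    What is needed of F is recorded in [admissible]: it preserves dimension and
    orthogonality, and it sends two subspaces that differ in one vector of an
    orthonormal basis to subspaces meeting in codimension at most one. Both (A)
    and (OA) provide this ([admissible_on_sets]), and the descent inherits it
    ([admissible_descent]): the values of the descent at two such subspaces are
    hyperplanes in the image of their sum.

    Lines. At the bottom there is a map of lines that preserves orthogonality
    and takes the lines of a plane to lines of a plane, and F X is spanned by
    the images of the lines in X ([descend_to_lines]). Distinct lines have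
    distinct images, for otherwise F would agree on two adjacent subspaces.

    Wigner's argument. Fix a unit vector e and a unit vector e' on the image of
    its line. For x orthogonal to e, the image of the line of e + x is the line
    of e' + L x for exactly one L x orthogonal to e'. Comparing planes through
    e + x + y shows that L is additive, and then that it is semilinear for one
    ring endomorphism s of the complex numbers. If the inner product of x and y
    is -1, then e + x and e + y are orthogonal, and hence so are e' + L x and
    e' + L y; this makes s commute with conjugation and makes L transform the
    squared norm by s ([semilinear_representative]). An endomorphism that
    commutes with conjugation is monotone on the reals, thus the identity there,
    and so it is the identity or the conjugation
    ([complex_endo_id_or_conj]). *)

Set Implicit Arguments.
Unset Strict Implicit.
Unset Printing Implicit Defensive.

Import Order.TTheory GRing.Theory Num.Theory.
Import numFieldNormedType.Exports.
Local Open Scope classical_set_scope.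
Local Open Scope ring_scope.

(** * Orthonormal families and finite-dimensional subspaces *)

Section Orthonormal.
Context {C : numClosedFieldType} {H : lmodType C}.
Variable dot : {dot H for Num.conj}.
Local Notation "''[' x , y ]" := (dot x y).
Local Notation orthonormal := (orthonormal dot).
Implicit Types (s t : seq H) (e p q r : H).

Lemma dotDl x y z : '[x + y, z] = '[x, z] + '[y, z].
Proof. exact: linearDl. Qed.

Lemma dotDr x y z : '[z, x + y] = '[z, x] + '[z, y].
Proof. exact: linearDr. Qed.

Lemma dotBl x y z : '[x - y, z] = '[x, z] - '[y, z].
Proof. exact: linearBl. Qed.

Lemma dotZl a x z : '[a *: x, z] = a * '[x, z].
Proof. exact: linearZl_LR. Qed.

Lemma dotZr a x z : '[z, a *: x] = a^* * '[z, x].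
Proof. exact: linearZr_LR. Qed.

Lemma dot0l z : '[0, z] = 0.
Proof. exact: linear0l. Qed.

Lemma dot0r z : '[z, 0] = 0.
Proof. exact: linear0r. Qed.

Lemma dotC x y : '[x, y] = '[y, x]^*.
Proof. by rewrite [LHS](hermC dot) expr0 mul1r. Qed.

Lemma dot_sym0 x y : '[x, y] = 0 -> '[y, x] = 0.
Proof. by move=> h; rewrite dotC h conjC0. Qed.

Lemma dotxx0 x : '[x, x] = 0 -> x = 0.
Proof. by move/eqP; rewrite dnorm_eq0 => /eqP. Qed.

Lemma dot_suml (I : Type) (r : seq I) (P : pred I) (E : I -> H) z :
  '[\sum_(i <- r | P i) E i, z] = \sum_(i <- r | P i) '[E i, z].
Proof. exact: linear_sumlz. Qed.

Lemma dot_sumr (I : Type) (r : seq I) (P : pred I) (E : I -> H) z :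
  '[z, \sum_(i <- r | P i) E i] = \sum_(i <- r | P i) '[z, E i].
Proof. exact: linear_sumr. Qed.

Lemma unit_scale z : z != 0 -> exists2 a, a != 0 & '[a *: z, a *: z] = 1.
Proof.
move=> z0; have h : 0 < '[z, z] by rewrite dnorm_gt0.
exists (sqrtC '[z, z])^-1; first by rewrite invr_eq0 sqrtC_eq0 gt_eqF.
rewrite dnormZ normfV ger0_norm ?sqrtC_ge0 ?ltW// exprVn sqrtCK.
by rewrite mulVf// gt_eqF.
Qed.

Lemma orthonormal_cons e s :
  orthonormal (e :: s) <-> [/\ '[e, e] = 1, {in s, forall x, '[e, x] = 0} &
    orthonormal s].
Proof.
split.
  move/orthonormalP => [/= /andP[es us] h]; split.
  - by rewrite h ?mem_head// eqxx.
  - move=> x xs; rewrite h ?mem_head ?in_cons ?xs ?orbT//.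
    by case: eqVneq es => // ->; rewrite xs.
  - by apply/orthonormalP; split=> // x y xs ys; apply: h;
    rewrite in_cons ?xs ?ys orbT.
move=> [ee es /orthonormalP[us h]].
have ens : e \notin s.
  by apply/negP => /es; rewrite ee => /eqP; rewrite oner_eq0.
apply/orthonormalP; split=> /=; first by rewrite ens.
move=> x y; rewrite !in_cons => /orP[/eqP->|xs] /orP[/eqP->|ys].
- by rewrite eqxx.
- by rewrite es//; case: eqVneq ens => // ->; rewrite ys.
- by rewrite (dot_sym0 (es _ xs)); case: eqVneq ens => // <-; rewrite xs.
- exact: h.
Qed.

(** Stated with multiplicities so that rearranging and dropping parts of a
    concatenation reduces to linear arithmetic on counts. *)
Lemma orthonormal_count t s : (forall P, (count P s <= count P t)%N) ->
  orthonormal t -> orthonormal s.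
Proof.
move=> h /orthonormalP[ut ht].
have hs x : x \in s -> x \in t.
  by rewrite -!has_pred1 !has_count => /leq_trans; apply.
apply/orthonormalP; split=> [|x y xs ys]; last exact: ht (hs _ xs) (hs _ ys).
apply: count_mem_uniq => x; have := h (pred1 x); rewrite (count_uniq_mem _ ut).
case: (boolP (x \in s)) => [xs|/count_memPn //].
by rewrite hs// => xle; apply/eqP; rewrite eqn_leq xle -has_count has_pred1.
Qed.

Definition oproj (s : seq H) (x : H) : H := \sum_(e <- s) '[x, e] *: e.

(** The fixed points of the projection: for orthonormal s this is the linear
    span of s, with membership given by an equation. *)
Definition ospan (s : seq H) : set H := [set x | oproj s x = x].

Lemma oprojP s x : orthonormal s -> {in s, forall e, '[oproj s x, e] = '[x, e]}.
Proof.
move=> /orthonormalP[us h] e es;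
  rewrite /oproj dot_suml (bigD1_seq e)//= dotZl (h e e)//.
rewrite eqxx mulr1 big1_seq ?addr0// => e' /andP[ne e's].
by rewrite dotZl (h e' e)// (negPf ne) mulr0.
Qed.

Lemma oprojB s x : orthonormal s -> {in s, forall e, '[x - oproj s x, e] = 0}.
Proof. by move=> ons e es; rewrite dotBl oprojP// subrr. Qed.

Definition submod (X : set H) : Prop :=
  X 0 /\ forall a x y, X x -> X y -> X (a *: x + y).

Lemma submodZ X a x : submod X -> X x -> X (a *: x).
Proof. by move=> [X0 h] Xx; rewrite -[_ *: _]addr0; apply: h. Qed.

Lemma submodD X x y : submod X -> X x -> X y -> X (x + y).
Proof. by move=> [X0 h] Xx Xy; rewrite -[x]scale1r; apply: h. Qed.

Lemma submodB X x y : submod X -> X x -> X y -> X (x - y).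
Proof. by move=> [X0 h] Xx Xy; rewrite addrC -scaleN1r; apply: h. Qed.

Lemma submod_sum X (I : eqType) (r : seq I) (E : I -> H) :
  submod X -> {in r, forall i, X (E i)} -> X (\sum_(i <- r) E i).
Proof.
move=> sX h; rewrite big_seq; apply: (@big_ind _ X) => //; first by case: sX.
by move=> x y; apply: submodD.
Qed.

Lemma submod_ospan s : submod (ospan s).
Proof.
split; rewrite /ospan /oproj /=.
  by rewrite big1// => e _; rewrite dot0l scale0r.
move=> a x y hx hy; rewrite -{2}hx -{2}hy scaler_sumr -big_split/=.
by apply: eq_bigr => e _; rewrite dotDl dotZl scalerDl scalerA.
Qed.

Lemma oproj_sub X s x : submod X -> {in s, forall e, X e} -> X (oproj s x).
Proof. by move=> sX h; apply: submod_sum => // e es; apply: submodZ => //;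
  exact: h. Qed.

Lemma ospan_sub X s : submod X -> {in s, forall e, X e} -> ospan s `<=` X.
Proof. by move=> sX h x; rewrite /ospan /= => <-; apply: oproj_sub. Qed.

Lemma ospan_mem s e : orthonormal s -> e \in s -> ospan s e.
Proof.
move=> /orthonormalP[us h] es;
  rewrite /ospan /oproj /= (bigD1_seq e)//= h// eqxx scale1r.
rewrite big1_seq ?addr0// => e' /andP[ne e's].
by rewrite h// eq_sym (negPf ne) scale0r.
Qed.

Lemma ospan_sub_mem s t : orthonormal t -> {subset s <= t} ->
  ospan s `<=` ospan t.
Proof.
by move=> ont h; apply: ospan_sub; [exact: submod_ospan|move=> e /h;
  exact: ospan_mem].
Qed.

Lemma ospan_perm s t : (forall P, count P s = count P t) -> ospan s = ospan t.
Proof.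
move=> /permP st; apply/seteqP.
by split=> x; rewrite /ospan /oproj /= => {2}<-;
  [rewrite -(perm_big _ st)|rewrite (perm_big _ st)].
Qed.

Lemma orth_ospan s z x : {in s, forall e, '[z, e] = 0} -> ospan s x ->
  '[z, x] = 0.
Proof.
move=> h; apply: (ospan_sub (X := [set x | '[z, x] = 0])) => //.
by split=> [|a u v] /=; [exact: dot0r|rewrite dotDr dotZr => -> ->;
  rewrite mulr0 addr0].
Qed.

Lemma oproj_in s x : orthonormal s -> ospan s (oproj s x).
Proof.
by move=> ons; apply: oproj_sub => [|e]; [exact: submod_ospan|exact: ospan_mem].
Qed.

Lemma ospan_new_vector s y : orthonormal s -> ~ ospan s y ->
  exists a, a != 0 /\ orthonormal (a *: (y - oproj s y) :: s).
Proof.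
move=> ons ny.
have /unit_scale[a a0 ha] : y - oproj s y != 0.
  by rewrite subr_eq0; apply/eqP => h; apply: ny; rewrite /ospan /= -h.
exists a; split=> //; apply/orthonormal_cons; split=> // x xs.
by rewrite dotZl oprojB// mulr0.
Qed.

(** Fewer than n linear equations in n unknowns have a nonzero solution. All
    dimension counts below rest on this. *)
Lemma orth_in_lspan n (v : 'I_n -> H) (t : seq H) : lin_indep v ->
  (size t < n)%N ->
  exists x, [/\ lspan v x, x != 0 & {in t, forall y, '[x, y] = 0}].
Proof.
move=> iv st.
pose M := \matrix_(i < n, j < size t) '[v i, t`_j].
have /rowV0Pn[u /sub_kermxP uM u0] : kermx M != 0.
  rewrite kermx_eq0; apply: contraL st => /eqP <-; rewrite -leqNgt.
  exact: rank_leq_col.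
exists (\sum_i u 0 i *: v i); split; first by exists (u 0).
  apply: contra u0 => /eqP /iv h; apply/eqP/rowP => i; rewrite h mxE//.
move=> y /(nthP 0)[j jt <-].
move: uM => /rowP/(_ (Ordinal jt)); rewrite !mxE => <-.
by rewrite dot_suml; apply: eq_bigr => i _; rewrite dotZl !mxE.
Qed.

Lemma lspan_submod n (v : 'I_n -> H) : submod (lspan v).
Proof.
split; first by exists (fun=> 0); rewrite big1// => i _; rewrite scale0r.
move=> a x y [b ->] [c ->]; exists (fun i => a * b i + c i).
rewrite scaler_sumr -big_split; apply: eq_bigr => i _ /=.
by rewrite scalerDl scalerA.
Qed.

Lemma orthonormal_indep s : orthonormal s ->
  lin_indep (fun i : 'I_(size s) => s`_i).
Proof.
move=> /orthonormalP[us h] a a0 i.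
have: '[\sum_(j < size s) a j *: s`_j, s`_i] = 0 by rewrite a0 dot0l.
rewrite dot_suml (bigD1 i)//= dotZl h ?mem_nth// eqxx mulr1 big1 ?addr0//.
move=> j ji; rewrite dotZl h ?mem_nth// nth_uniq// ?ltn_ord//.
by rewrite (_ : (nat_of_ord j == i) = false) ?mulr0//; apply/negbTE.
Qed.

Lemma ospan_lspan s : orthonormal s ->
  ospan s = lspan (fun i : 'I_(size s) => s`_i).
Proof.
move=> ons; apply/seteqP; split.
  move=> x; rewrite /ospan /oproj /= (big_nth 0) big_mkord => hx.
  by exists (fun i => '[x, s`_i]).
move=> x [a ->]; apply: submod_sum => [|i _]; first exact: submod_ospan.
by apply: submodZ; [exact: submod_ospan | apply: ospan_mem => //;
  exact: mem_nth].
Qed.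

Lemma orth_in_ospan s t : orthonormal s -> (size t < size s)%N ->
  exists x, [/\ ospan s x, x != 0 & {in t, forall y, '[x, y] = 0}].
Proof. by move=> ons; rewrite ospan_lspan//;
  apply/orth_in_lspan/orthonormal_indep. Qed.

Lemma ospan_leq s t : orthonormal s -> orthonormal t -> ospan s `<=` ospan t ->
  (size s <= size t)%N.
Proof.
move=> ons ont st; rewrite leqNgt;
  apply/negP => /(orth_in_ospan ons)[x [xs x0 xt]].
by move/eqP: x0; apply; apply: dotxx0; apply: orth_ospan xt (st _ xs).
Qed.

Lemma ospan_eq s t : orthonormal s -> orthonormal t -> ospan s `<=` ospan t ->
  (size t <= size s)%N ->
  ospan s = ospan t.
Proof.
move=> ons ont st le; apply/seteqP; split=> // y ty.
apply: contrapT => /(ospan_new_vector ons)[a [a0 ona]].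
have := ospan_leq ona ont; rewrite /= ltnNge le => h; apply/notF/h.
apply: ospan_sub => [|e]; first exact: submod_ospan.
rewrite in_cons => /orP[/eqP->|/(ospan_mem ons)/st//].
apply: submodZ; first exact: submod_ospan.
by apply: submodB => //; [exact: submod_ospan|apply/st/oproj_in].
Qed.

Lemma ospan_extend s t : orthonormal s -> orthonormal t ->
  ospan t `<=` ospan s ->
  exists u, orthonormal (u ++ t) /\ ospan (u ++ t) = ospan s.
Proof.
move=> ons; move: {2}(size s - size t)%N (leqnn (size s - size t)) => m.
elim: m t => [|m IH] t hm ont ts.
  by exists [::]; split=> //; apply: ospan_eq => //; rewrite -subn_eq0 -leqn0.
have [le|lt] := leqP (size s) (size t); first by apply: IH => //; lia.
have [x [xs x0 xt]] := orth_in_ospan ons lt.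
have [a a0 ha] := unit_scale x0.
have ona : orthonormal (a *: x :: t).
  by apply/orthonormal_cons; split=> // y /xt; rewrite dotZl => ->;
    rewrite mulr0.
have [|//||u] := IH (a *: x :: t); first by rewrite /=; lia.
  apply: ospan_sub => [|e]; first exact: submod_ospan.
  rewrite in_cons => /orP[/eqP->|/(ospan_mem ont)/ts//].
  by apply: submodZ => //; exact: submod_ospan.
by rewrite -cat_rcons => -[onu <-]; exists (rcons u (a *: x)).
Qed.

(** Gram-Schmidt: as long as fewer than n orthonormal vectors have been found,
    [orth_in_lspan] gives another one. *)
Lemma has_dimP n (X : set H) : has_dim n X <->
  exists s, [/\ orthonormal s, size s = n & X = ospan s].
Proof.
split; last first.
  move=> [s [ons <- ->]]; rewrite ospan_lspan//.
  by eexists; [exact: orthonormal_indep|].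
move=> [v iv ->].
have [s [ons ss sv]] : exists s, [/\ orthonormal s, size s = n & ospan s `<=`
  lspan v].
  suff: forall j, (j <= n)%N ->
      exists s, [/\ orthonormal s, size s = j & {in s, forall e, lspan v e}].
    move=> /(_ n (leqnn n))[s [ons ss sv]]; exists s; split=> //.
    by apply: ospan_sub => //; exact: lspan_submod.
  elim=> [_|j IH jn]; first by exists [::].
  have [s [ons ss sv]] := IH (ltnW jn).
  have [|x [xv x0 xs]] := orth_in_lspan (t := s) iv; first by rewrite ss.
  have [a a0 ha] := unit_scale x0.
  exists (a *: x :: s); split; rewrite /= ?ss//.
    by apply/orthonormal_cons; split=> // y /xs; rewrite dotZl => ->;
      rewrite mulr0.
  move=> e; rewrite in_cons => /orP[/eqP->|/sv//].
  by apply: submodZ => //; exact: lspan_submod.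
exists s; split=> //; apply/seteqP; split=> // y vy.
apply: contrapT => /(ospan_new_vector ons)[a [a0 ona]].
have [|x [xs x0 xv]] := orth_in_ospan (t := [seq v i | i <- enum 'I_n]) ona.
  by rewrite size_map size_enum_ord /= ss.
move/eqP: x0; apply; apply: dotxx0.
have [b xb] : lspan v x.
  apply: ospan_sub xs; first exact: lspan_submod.
  move=> e; rewrite in_cons => /orP[/eqP->|/(ospan_mem ons)/sv//].
  apply: submodZ; first exact: lspan_submod.
  by apply: submodB => //; [exact: lspan_submod|apply/sv/oproj_in].
rewrite {2}xb dot_sumr big1// => i _; rewrite dotZr xv ?mulr0//.
by apply: map_f; rewrite mem_enum.
Qed.

Lemma has_dim_ospan s : orthonormal s -> has_dim (size s) (ospan s).
Proof. by move=> ons; apply/has_dimP; exists s. Qed.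

Lemma has_dim_submod n X : has_dim n X -> submod X.
Proof. by move=> [v _ ->]; exact: lspan_submod. Qed.

Lemma has_dim_extend n X s : has_dim n X -> orthonormal s -> ospan s `<=` X ->
  exists u, [/\ orthonormal (u ++ s), (size u + size s)%N = n & X = ospan (u ++
    s)].
Proof.
move=> /has_dimP[t [ont <- ->]] ons st.
have [u [onu ut]] := ospan_extend ont ons st; exists u; split=> //.
by rewrite -size_cat; apply/eqP; rewrite eqn_leq !ospan_leq ?ut.
Qed.

Lemma has_dim_eq n X s : has_dim n X -> orthonormal s -> ospan s `<=` X ->
  size s = n ->
  X = ospan s.
Proof.
by move=> /has_dimP[t [ont <- ->]] ons st ss; rewrite (ospan_eq ons ont) ?ss.
Qed.

Lemma orth_in_has_dim n X t : has_dim n X -> (size t < n)%N ->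
  exists x, [/\ X x, x != 0 & {in t, forall y, '[x, y] = 0}].
Proof. by move=> [v iv ->]; exact: orth_in_lspan. Qed.

Lemma has_dim_perp n X x : has_dim n.+1 X -> X x -> x != 0 ->
  has_dim n (X `&` [set y | '[y, x] = 0]).
Proof.
move=> dX Xx x0; have [a a0 ha] := unit_scale x0.
have onx : orthonormal [:: a *: x] by apply/orthonormal_cons.
have [|u [onu su Xu]] := has_dim_extend dX onx.
  apply: ospan_sub => [|e]; first exact: has_dim_submod dX.
  by rewrite inE => /eqP ->; apply: submodZ => //; exact: has_dim_submod dX.
have [_ xu onu'] : [/\ '[a *: x, a *: x] = 1, {in u, forall y, '[a *: x, y] = 0}
    & orthonormal u].
  apply/orthonormal_cons; apply: orthonormal_count onu => P;
    rewrite count_cat /=; lia.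
apply/has_dimP; exists u; split=> //; first by move: su => /=; lia.
apply/seteqP; split=> y /=.
  move=> [Xy yx]; move: Xy; rewrite Xu /ospan /oproj /= big_cat big_seq1 /=.
  by rewrite dotZr yx mulr0 scale0r addr0.
move=> uy; split; first by rewrite Xu; apply: ospan_sub_mem uy => // e;
  rewrite mem_cat => ->.
apply: dot_sym0; apply/eqP; rewrite -(mulrI_eq0 _ (mulfI a0)) -dotZl.
by apply/eqP/(orth_ospan xu).
Qed.

(** B and the orthogonal complement of x in X have the same dimension, so the
    inclusion of the first in the second is an equality. *)
Lemma mem_hyperplane n X B x : has_dim n.+1 X -> has_dim n B -> B `<=` X ->
  X x -> x != 0 -> (forall y, B y -> '[y, x] = 0) ->
  forall y, X y -> '[y, x] = 0 -> B y.
Proof.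
move=> dX dB BX Xx x0 Bx y Xy yx.
have /has_dimP[s [ons ss Bs]] := dB.
rewrite Bs -(has_dim_eq (has_dim_perp dX Xx x0) ons)//.
by rewrite -Bs => z Bz; split; [exact: BX|exact: Bx].
Qed.

Lemma hyperplane_normal n X B : has_dim n.+1 X -> has_dim n B -> B `<=` X ->
  exists c, forall y, X y -> '[y, c] = 0 -> B y.
Proof.
move=> dX dB BX; have /has_dimP[s [ons ss Bs]] := dB.
have [|x [Xx x0 xs]] := orth_in_has_dim (t := s) dX; first by rewrite ss.
exists x; apply: (mem_hyperplane dX dB BX Xx x0) => y; rewrite Bs => sy.
by apply: dot_sym0; apply: orth_ospan sy.
Qed.

Lemma dim_gt_perp N (t : seq H) : dim_gt H N -> (size t <= N)%N ->
  exists2 e, '[e, e] = 1 & {in t, forall y, '[e, y] = 0}.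
Proof.
move=> [v iv] st; have [//|x [_ x0 xt]] := orth_in_lspan (t := t) iv.
have [a a0 ha] := unit_scale x0; exists (a *: x) => // y /xt.
by rewrite dotZl => ->; rewrite mulr0.
Qed.

End Orthonormal.

(** * Lowering the dimension *)

(** Any rearranged part of the orthonormal family in h is orthonormal. *)
Ltac part_of h := by apply: orthonormal_count h => ?;
  rewrite /= ?count_cat /= ?count_cat /=; lia.
Ltac same_ospan := by apply: ospan_perm => ?;
  rewrite /= ?count_cat /= ?count_cat /=; lia.

Section Descent.
Context {C : numClosedFieldType} {H : lmodType C}.
Variable dot : {dot H for Num.conj}.
Local Notation "''[' x , y ]" := (dot x y).
Local Notation orthonormal := (orthonormal dot).
Implicit Types (s t : seq H) (e p q r : H).
Local Notation ospan := (ospan dot).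

Lemma orthonormal_extend N m s : dim_gt H N -> (size s + m <= N.+1)%N ->
  orthonormal s ->
  exists t, size t = m /\ orthonormal (t ++ s).
Proof.
move=> dH; elim: m => [|m IH] sm ons; first by exists [::].
have [|t [st ont]] := IH _ ons; first by lia.
have [|e ee et] := @dim_gt_perp _ _ dot N (t ++ s) dH.
  by rewrite size_cat; lia.
by exists (e :: t); split; [rewrite /= st|apply/orthonormal_cons].
Qed.

Lemma orthonormal_extend1 N s : dim_gt H N -> (size s <= N)%N ->
  orthonormal s ->
  exists e, orthonormal (e :: s).
Proof.
move=> dH sm ons; have [|t [st h]] := @orthonormal_extend N 1 _ dH _ ons;
  first by lia.
by case: t st h => [|e []]//= _ h; exists e.
Qed.

Lemma dim_gt_leq M N : (N <= M)%N -> dim_gt H M -> dim_gt H N.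
Proof.
move=> NM dH; have [//|//|t [st]] := @orthonormal_extend _ N.+1 [::] dH.
by rewrite cats0 => /orthonormal_indep; rewrite st => h; eexists; exact: h.
Qed.

Lemma orthonormal_cat_orth s t : orthonormal (s ++ t) ->
  orthogonal_sets dot (ospan s) (ospan t).
Proof.
move=> onst x y sx; apply: orth_ospan => e et; apply: dot_sym0.
apply: orth_ospan sx => z zs; apply: dot_sym0.
have /orthonormalP[u h] := onst; rewrite h ?mem_cat ?zs ?et ?orbT//.
case: eqVneq => // ze; move: u; rewrite cat_uniq => /and3P[_ /hasPn/(_ _ et)].
by rewrite -ze /= zs.
Qed.

Lemma orthonormal_append s t : orthonormal s -> orthonormal t ->
  {in s & t, forall x y, '[x, y] = 0} -> orthonormal (s ++ t).
Proof.
elim: s => //= e s IH /orthonormal_cons[ee es ons] ont h;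
  apply/orthonormal_cons; split=> //.
  by move=> x; rewrite mem_cat => /orP[/es//|xt]; apply: h; rewrite ?mem_head.
by apply: IH => // x y xs yt; apply: h; rewrite ?in_cons ?xs ?orbT.
Qed.

(** The last condition says that the two images meet in codimension at most one,
    in the form: a single linear equation cuts the first image down to a part of
    the second. Coincidence of the two images is allowed; this weak form passes
    to lower dimensions at no cost. *)
Definition admissible n (F : set H -> set H) : Prop :=
  [/\ forall X, has_dim n X -> has_dim n (F X),
      forall X Y, has_dim n X -> has_dim n Y -> orthogonal_sets dot X Y ->
        orthogonal_sets dot (F X) (F Y)
    & forall p q s, orthonormal (p :: q :: s) -> (size s).+1 = n ->
        exists c, forall y, F (ospan (p :: s)) y -> '[y, c] = 0 ->
          F (ospan (q :: s)) y].

(** Replacing the vectors of t by those of s one after the other imposes one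
    linear equation per step, so the images of u+t and u+s meet in codimension
    at most the size of s. *)
Lemma exchange_path n F s t u : admissible n F -> size s = size t ->
  orthonormal (u ++ s ++ t) ->
  (size u + size s)%N = n ->
  exists c, size c = size s /\ forall y, F (ospan (u ++ t)) y ->
    {in c, forall z, '[y, z] = 0} -> F (ospan (u ++ s)) y.
Proof.
move=> gF; elim: s t u => [|a s IH] [|b t] u //=.
  by move=> _ _ _; exists [::].
move=> [st] onst su.
have [//|||c [sc hc]] := IH t (b :: u).
- part_of onst.
- by rewrite /= -su; lia.
have [_ _ /(_ b a (u ++ s))[]] := gF.
- part_of onst.
- by rewrite size_cat -su; lia.
move=> d hd; exists (d :: c); split; first by rewrite /= sc.
move=> y Fy cy.
have -> : ospan (u ++ a :: s) = ospan (a :: u ++ s) by same_ospan.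
apply: hd; last by apply: cy; rewrite mem_head.
apply: hc => [|z zc]; last by apply: cy; rewrite in_cons zc orbT.
by rewrite (_ : ospan _ = ospan (u ++ b :: t)) //; same_ospan.
Qed.

Section StarCenter.
Variables (n : nat) (F : set H -> set H).
Hypotheses (n_gt0 : (0 < n)%N) (gF : admissible n.+1 F).
Hypothesis dimH : dim_gt H (2 * n).+2.

(** The vector x lies in the images of s+r and of t+r, where t is orthogonal to
    everything else. It is orthogonal to the images of s+p and s+q because t+r
    is orthogonal to s+p and s+q, and it exists because n exchanges lead from t
    to s, while the images have dimension n+1. *)
Lemma star_normal p q r s : orthonormal (p :: q :: r :: s) -> size s = n ->
  exists x, [/\ F (ospan (r :: s)) x, x != 0,
    forall y, F (ospan (p :: s)) y -> '[y, x] = 0 &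
    forall y, F (ospan (q :: s)) y -> '[y, x] = 0].
Proof.
move=> ons ss; have [dF oF _] := gF.
have [|t [st ont]] := @orthonormal_extend _ n _ dimH _ ons;
  first by rewrite /= ss; lia.
have dS e l : orthonormal (e :: l) -> size l = n ->
  has_dim n.+1 (ospan (e :: l)).
  by move=> /has_dim_ospan /= + sl; rewrite sl.
have onr : orthonormal (r :: s) by part_of ons.
have onrt : orthonormal (r :: t) by part_of ont.
have [|||c [sc hc]] := @exchange_path _ F t s [:: r] gF.
- by rewrite ss st.
- part_of ont.
- by rewrite /= st.
have [|x [Dx x0 xc]] := orth_in_has_dim dot (t := c) (dF _ (dS _ _ onr ss)).
  by rewrite sc st.
have Zx := hc _ Dx xc; exists x; split=> // y.
  have onp : orthonormal (p :: s) by part_of ons.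
  move=> Py; apply: (oF _ _ _ _ _ _ _ Py Zx); [exact: dS|exact: dS|].
  by apply: orthonormal_cat_orth; part_of ont.
have onq : orthonormal (q :: s) by part_of ons.
move=> Py; apply: (oF _ _ _ _ _ _ _ Py Zx); [exact: dS|exact: dS|].
by apply: orthonormal_cat_orth; part_of ont.
Qed.

(** One equation c cuts the image D of s+r down to a part of the image A of s+p,
    and x, being orthogonal to A, does not satisfy it. So every y in D becomes
    an element of A after subtracting a multiple of x; if y is orthogonal to x,
    then so is the result, and the multiple is zero. *)
Lemma star_perp p r s x : orthonormal (p :: r :: s) -> size s = n ->
  F (ospan (r :: s)) x -> x != 0 ->
  (forall y, F (ospan (p :: s)) y -> '[y, x] = 0) ->
  F (ospan (p :: s)) `&` F (ospan (r :: s)) =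
  F (ospan (r :: s)) `&` [set y | '[y, x] = 0].
Proof.
move=> ons ss Dx x0 Ax; apply/seteqP; split=> y /= [].
  by move=> Ay Dy; split=> //; exact: Ax.
move=> Dy yx; split=> //.
have [dF _ aF] := gF.
have onr : orthonormal (r :: p :: s) by part_of ons.
have [|c hc] := aF _ _ _ onr; first by rewrite ss.
have sD : submod (F (ospan (r :: s))).
  apply: has_dim_submod; apply: dF; rewrite -ss.
  by apply: (@has_dim_ospan _ _ dot (r :: s)); part_of ons.
have xc : '[x, c] != 0.
  apply/eqP => /(hc _ Dx)/Ax/dotxx0; exact/eqP.
pose l := '[y, c] / '[x, c].
have hA : F (ospan (p :: s)) (y - l *: x).
  apply: hc; first by apply: submodB => //; exact: submodZ.
  by rewrite dotBl dotZl /l mulfVK// subrr.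
have /eqP := Ax _ hA; rewrite dotBl dotZl yx sub0r oppr_eq0 mulf_eq0.
by case/orP=> /eqP h; [move: hA; rewrite h scale0r subr0|case/eqP: x0;
  exact: dotxx0 h].
Qed.

(** Both sides are the orthogonal complement of one vector in the image of
    s+r. *)
Lemma star_meet p q r s : orthonormal (p :: q :: r :: s) -> size s = n ->
  F (ospan (p :: s)) `&` F (ospan (r :: s)) =
    F (ospan (q :: s)) `&` F (ospan (r :: s)).
Proof.
move=> ons ss; have [x [Dx x0 px qx]] := star_normal ons ss.
by rewrite !(star_perp _ ss Dx x0)//; part_of ons.
Qed.

Lemma star_dim p q s : orthonormal (p :: q :: s) -> size s = n ->
  has_dim n (F (ospan (p :: s)) `&` F (ospan (q :: s))).
Proof.
move=> ons ss; have [|r onr] := @orthonormal_extend1 _ _ dimH _ ons.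
  by rewrite /= ss; lia.
have onr' : orthonormal (r :: p :: q :: s) by part_of onr.
have [x [Dx x0 _ px]] := star_normal onr' ss.
rewrite (star_perp ons ss Dx x0 px); apply: has_dim_perp => //.
have [dF _ _] := gF; apply: dF; rewrite -ss.
by apply: (@has_dim_ospan _ _ dot (q :: s)); part_of ons.
Qed.

(** By [star_meet] one vector of an orthogonal pair can be exchanged for a third
    vector orthogonal to both; a vector r orthogonal to all those in question
    links any two pairs. *)
Lemma star_center s : size s = n -> forall p q p' q',
  orthonormal (p :: q :: s) -> orthonormal (p' :: q' :: s) ->
  F (ospan (p :: s)) `&` F (ospan (q :: s)) =
    F (ospan (p' :: s)) `&` F (ospan (q' :: s)).
Proof.
move=> ss.
have shift p q q' : orthonormal (p :: q :: s) -> orthonormal (p :: q' :: s) ->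
    F (ospan (p :: s)) `&` F (ospan (q :: s)) =
      F (ospan (p :: s)) `&` F (ospan (q' :: s)).
  move=> onq onq'.
  have [|r rr hr] := @dim_gt_perp _ _ dot _ (q' :: p :: q :: s) dimH.
    by rewrite /= ss; lia.
  rewrite !(setIC (F (ospan (p :: s)))).
  transitivity (F (ospan (r :: s)) `&` F (ospan (p :: s))).
    apply: star_meet => //.
    have h : orthonormal (r :: p :: q :: s).
      by apply/orthonormal_cons; split=> // x xs; apply: hr;
        rewrite in_cons xs orbT.
    part_of h.
  apply: star_meet => //.
  have h : orthonormal (r :: p :: q' :: s).
    apply/orthonormal_cons; split=> // x xs; apply: hr.
    by move: xs; rewrite !in_cons => /or3P[] -> //; rewrite !orbT.
  part_of h.
move=> p q p' q' onp onp'.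
have [|r rr hr] := @dim_gt_perp _ _ dot _ (p :: p' :: s) dimH.
  by rewrite /= ss; lia.
have onpr : orthonormal (p :: r :: s).
  have h : orthonormal (r :: p :: s).
    apply/orthonormal_cons; split=> //; last by part_of onp.
    by move=> x xs; apply: hr; move: xs; rewrite !in_cons => /orP[] ->;
      rewrite ?orbT.
  part_of h.
have onpr' : orthonormal (p' :: r :: s).
  have h : orthonormal (r :: p' :: s).
    apply/orthonormal_cons; split=> //; last by part_of onp'.
    by move=> x xs; apply: hr; rewrite in_cons xs orbT.
  part_of h.
rewrite (shift _ _ _ onp onpr) -(shift _ _ _ onpr' onp').
rewrite !(setIC _ (F (ospan (r :: s)))).
by apply: shift; [part_of onpr|part_of onpr'].
Qed.

(** The intersection of the images of all X containing S; it is the common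
    subspace provided by [star_center]. *)
Definition descent (S : set H) : set H :=
  [set y | forall X, has_dim n.+1 X -> S `<=` X -> F X y].

Lemma descentE p q s : orthonormal (p :: q :: s) -> size s = n ->
  descent (ospan s) = F (ospan (p :: s)) `&` F (ospan (q :: s)).
Proof.
move=> ons ss; have onp : orthonormal (p :: s) by part_of ons.
have onq : orthonormal (q :: s) by part_of ons.
have on_s : orthonormal s by part_of ons.
apply/seteqP; split=> y.
  move=> h; split; apply: h.
  - by rewrite -ss; exact: (has_dim_ospan onp).
  - by apply: ospan_sub_mem => // e es; rewrite in_cons es orbT.
  - by rewrite -ss; exact: (has_dim_ospan onq).
  - by apply: ospan_sub_mem => // e es; rewrite in_cons es orbT.
move=> hy X dX sX.
have [u [onu su XE]] := has_dim_extend dX on_s sX.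
have : size u = 1%N by lia.
case: u => [|a []]//= in onu su XE * => _.
have [|b onb] := @orthonormal_extend1 _ _ dimH _ onu; first by rewrite /= ss;
  lia.
have onab : orthonormal (a :: b :: s) by part_of onb.
by move: hy; rewrite XE (star_center ss ons onab) => -[].
Qed.

Lemma admissible_descent : admissible n descent.
Proof.
have [dF oF aF] := gF; split.
- move=> X /(has_dimP dot)[s [ons ss ->]].
  have [|t [st ont]] := @orthonormal_extend _ 2 _ dimH _ ons; first by lia.
  by case: t st ont => [|p [|q []]]//= _ ont; rewrite (descentE ont ss);
    exact: star_dim.
- move=> X Y dX dY oXY x y.
  have /(has_dimP dot)[s [ons ss XE]] := dX;
    have /(has_dimP dot)[t [ont st YE]] := dY.
  have onst : orthonormal (s ++ t).
    apply: orthonormal_append => // a b sa tb; apply: oXY; first by rewrite XE;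
      exact: ospan_mem.
    by rewrite YE; exact: ospan_mem.
  have [|l [sl onpq]] := @orthonormal_extend _ 2 _ dimH _ onst.
    by rewrite size_cat; lia.
  case: l sl onpq => [|p [|q []]]//= _ onpq.
  have [||r onr] := @orthonormal_extend1 _ [:: p, q & s] dimH.
  - by rewrite /= ss; lia.
  - by part_of onpq.
  have [||r' onr'] := @orthonormal_extend1 _ [:: p, q & t] dimH.
  - by rewrite /= st; lia.
  - by part_of onpq.
  rewrite XE YE (@descentE p r s) //; last by part_of onr.
  rewrite (@descentE q r' t) //; last by part_of onr'.
  move=> [Px _] [Qy _]; apply: (oF _ _ _ _ _ _ _ Px Qy).
  + rewrite -ss; apply: (@has_dim_ospan _ _ dot (p :: s)); part_of onpq.
  + rewrite -st; apply: (@has_dim_ospan _ _ dot (q :: t)); part_of onpq.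
  + by apply: orthonormal_cat_orth; part_of onpq.
(* Both values are hyperplanes in the image of p+q+s, so the equation of the
   second hyperplane will do. *)
- move=> p q s onpq ss.
  have [|a ona] := @orthonormal_extend1 _ _ dimH _ onpq; first by rewrite /=;
    lia.
  have dW : has_dim n.+1 (F (ospan (p :: q :: s))).
    by apply: dF; rewrite -ss; exact: has_dim_ospan onpq.
  have Ep : descent (ospan (p :: s)) =
      F (ospan (p :: q :: s)) `&` F (ospan (a :: p :: s)).
    rewrite (@descentE q a) //; last by part_of ona.
    by congr (F _ `&` _); same_ospan.
  have Eq : descent (ospan (q :: s)) =
      F (ospan (p :: q :: s)) `&` F (ospan (a :: q :: s)).
    by rewrite (@descentE p a) //; part_of ona.
  have dq : has_dim n (descent (ospan (q :: s))).
    rewrite (@descentE p a) //; last by part_of ona.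
    by apply: star_dim => //; part_of ona.
  have [|c hc] := hyperplane_normal dot dW dq; first by rewrite Eq => y [].
  by exists c => y; rewrite {1}Ep => -[Wy _]; exact: hc.
Qed.

End StarCenter.

(** The map F2 on planes is the last but one step of the iterated descent. It is
    kept because it shows that lines in a plane are sent to lines in a plane. *)
Lemma descend_to_lines k F : admissible k.+2 F -> dim_gt H (2 * k.+2) ->
  exists Phi F2, [/\ admissible 1 Phi, admissible 2 F2,
    forall P X, has_dim 1 P -> has_dim 2 X -> P `<=` X -> Phi P `<=` F2 X &
    forall P X, has_dim 1 P -> has_dim k.+2 X -> P `<=` X -> Phi P `<=` F X].
Proof.
elim: k F => [|k IH] F gF dimH.
  have h P X : has_dim 2 X -> P `<=` X -> descent 1 F P `<=` F X.
    by move=> dX PX y; apply.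
  exists (descent 1 F), F; split=> // [|P X _|P X _]; try exact: h.
  by apply: admissible_descent.
have [||Phi [F2 [g1 g2 h2 hk]]] := IH (descent k.+2 F).
- by apply: admissible_descent => //; rewrite (_ : _.+2 = 2 * k.+3)%N //; lia.
- by apply: dim_gt_leq dimH; lia.
exists Phi, F2; split=> // P X dP dX PX.
have /(has_dimP dot)[s [ons ss PE]] := dP.
have [|u [onu su XE]] := has_dim_extend dX ons; first by rewrite -PE.
case: u onu su XE => [|a u] onu su XE; first by move: su => /=; lia.
have onu' : orthonormal (u ++ s) by part_of onu.
apply: (@subset_trans _ (descent k.+2 F (ospan (u ++ s)))).
  apply: hk => //.
    apply/(has_dimP dot); exists (u ++ s); split=> //.
    by move: su; rewrite size_cat /=; lia.
  by rewrite PE; apply: ospan_sub_mem => // e es; rewrite mem_cat es orbT.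
move=> y; apply=> //; rewrite XE; apply: ospan_sub_mem => // e es.
by rewrite /= in_cons es orbT.
Qed.

End Descent.

(** * A semilinear map representing a map of lines *)

Section Wigner.
Context {C : numClosedFieldType} {H : lmodType C}.
Variable dot : {dot H for Num.conj}.
Local Notation "''[' x , y ]" := (dot x y).

Definition indep2 (x y : H) : Prop :=
  forall a b : C, a *: x + b *: y = 0 -> a = 0 /\ b = 0.

Lemma indep2_sym x y : indep2 x y -> indep2 y x.
Proof. by move=> h a b; rewrite addrC => /h[]. Qed.

Lemma indep2_neq0 x y : indep2 x y -> x != 0.
Proof.
move=> h; apply/eqP => x0; have [|/eqP] := h 1 0; last by rewrite oner_eq0.
by rewrite x0 scaler0 scale0r addr0.
Qed.

Lemma indep2_orth x y : x != 0 -> y != 0 -> '[x, y] = 0 -> indep2 x y.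
Proof.
move=> x0 y0 xy a b h.
have xx : '[x, x] != 0 by rewrite dnorm_eq0.
have yy : '[y, y] != 0 by rewrite dnorm_eq0.
have := dot0l dot x; rewrite -{1}h dotDl !dotZl (dot_sym0 xy) mulr0 addr0.
have := dot0l dot y; rewrite -{1}h dotDl !dotZl xy mulr0 add0r.
by move=> /eqP; rewrite mulf_eq0 (negPf yy) orbF => /eqP-> /eqP;
  rewrite mulf_eq0 (negPf xx) orbF => /eqP->.
Qed.

Lemma indep2_eq x y a b c d : indep2 x y ->
  a *: x + b *: y = c *: x + d *: y -> a = c /\ b = d.
Proof.
move=> h /eqP; rewrite -subr_eq0 opprD addrACA -!scalerBl => /eqP/h[].
by move=> /eqP + /eqP; rewrite !subr_eq0 => /eqP-> /eqP->.
Qed.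

Lemma indep2Z x y a b : a != 0 -> b != 0 -> indep2 x y ->
  indep2 (a *: x) (b *: y).
Proof.
move=> a0 b0 h c d; rewrite !scalerA => /h[/eqP + /eqP].
by rewrite !mulf_eq0 (negPf a0) (negPf b0) !orbF => /eqP-> /eqP->.
Qed.

Lemma not_indep2 x y : x != 0 -> ~ indep2 x y -> exists a, y = a *: x.
Proof.
move=> x0 /existsNP[a /existsNP[b /not_implyP[h]]].
have [b0|b0] := eqVneq b 0.
  move: h; rewrite b0 scale0r addr0 => /eqP; rewrite scaler_eq0 (negPf x0) orbF.
  by move=> /eqP a0 nab; exfalso; apply: nab.
move=> _; exists (- (b^-1 * a)); apply: (scalerI b0).
rewrite scalerA mulrN mulVKf// scaleNr; apply/eqP.
by rewrite -addr_eq0 addrC h.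
Qed.

(** The map of lines is given by a choice phi of a vector on the image of the
    line of each nonzero vector. *)
Section Construction.
Variable phi : H -> H.
Hypothesis phi_neq0 : forall x, x != 0 -> phi x != 0.
Hypothesis phi_orth : forall x y, x != 0 -> y != 0 ->
  '[x, y] = 0 -> '[phi x, phi y] = 0.
Hypothesis phiZ : forall a x, x != 0 -> a != 0 ->
  exists b, phi (a *: x) = b *: phi x.
Hypothesis phi_indep : forall x y, indep2 x y -> indep2 (phi x) (phi y).
Hypothesis phi_line : forall x y a b, indep2 x y -> a *: x + b *: y != 0 ->
  exists c d, phi (a *: x + b *: y) = c *: phi x + d *: phi y.
Hypothesis perp3 : forall x y z, exists2 w, '[w, w] = 1 &
  [/\ '[w, x] = 0, '[w, y] = 0 & '[w, z] = 0].

Variables e e' : H.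
Hypothesis ee : '[e, e] = 1.
Hypothesis ee' : '[e', e'] = 1.
Hypothesis e'E : exists2 a, a != 0 & e' = a *: phi e.

Let e0 : e != 0.
Proof. by rewrite -(dnorm_eq0 dot) ee oner_eq0. Qed.

Lemma affine_neq0 x : '[x, e] = 0 -> e + x != 0.
Proof.
move=> xe; apply/eqP => h; have := dot0l dot e.
by rewrite -h dotDl ee xe addr0 => /eqP; rewrite oner_eq0.
Qed.

Lemma affine_indep x : '[x, e] = 0 -> x != 0 -> indep2 e x.
Proof. by move=> xe x0; apply: indep2_orth => //; exact: dot_sym0. Qed.

(** The lines not orthogonal to e are those of e + x with x orthogonal to e, and
    likewise for e': x and y are coordinates of a line and of its image. *)
Definition affine_coord x y : Prop :=
  '[y, e'] = 0 /\ exists c, e' + y = c *: phi (e + x).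

Lemma affine_coord_inj x y y' : affine_coord x y -> affine_coord x y' -> y = y'.
Proof.
move=> [ye [c h]] [ye' [d h']].
have E z k : '[z, e'] = 0 -> e' + z = k *: phi (e + x) ->
    1 = k * '[phi (e + x), e'].
  by move=> ze hz; rewrite -dotZl -hz dotDl ee' ze addr0.
have := E _ _ ye h; rewrite {1}(E _ _ ye' h') => /(mulIf _) cd.
apply: (addrI e'); rewrite h h' cd//.
by apply/eqP => k0; have := E _ _ ye h; rewrite k0 mulr0 => /eqP;
  rewrite oner_eq0.
Qed.

(** The image of the line of e + x lies in the plane of phi e and phi x, and
    differs from the line of phi x by injectivity. *)
Lemma affine_coord_ex x : '[x, e] = 0 ->
  exists y, affine_coord x y /\ exists b, y = b *: phi x.
Proof.
move=> xe; have [a a0 e'a] := e'E.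
have [->|x0] := eqVneq x 0.
  exists 0; split; last by exists 0; rewrite scale0r.
  by split; [exact: dot0l|exists a; rewrite !addr0].
have ix := affine_indep xe x0.
have [|c [d]] := @phi_line e x 1 1 ix; rewrite !scale1r;
  first exact: affine_neq0.
move=> E; have c0 : c != 0.
  apply/eqP => c0; have : indep2 (phi (e + x)) (phi x).
    apply: phi_indep => u v; rewrite scalerDr -addrA -scalerDl => /ix[-> ].
    by rewrite add0r.
  move=> /(_ 1 (- d))[|/eqP]; last by rewrite oner_eq0.
  by rewrite E c0 scale0r add0r scale1r scaleNr subrr.
exists ((a / c * d) *: phi x); split; last by eexists.
split.
  rewrite e'a dotZl dotZr (phi_orth x0 e0 xe); by rewrite !mulr0.
by exists (a / c); rewrite E scalerDr !scalerA divfK// e'a.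
Qed.

(** This is L x in the comments; outside the complement of e it is arbitrary. *)
Definition perp_map x : H :=
  if pselect (exists y, affine_coord x y /\ exists b, y = b *: phi x) is left h
  then projT1 (cid h) else 0.

Lemma perp_mapP x : '[x, e] = 0 ->
  affine_coord x (perp_map x) /\ exists b, perp_map x = b *: phi x.
Proof.
move=> xe; rewrite /perp_map; case: pselect => [h|];
  last by have := affine_coord_ex xe.
by case: cid.
Qed.

Lemma perp_map_uniq x y : '[x, e] = 0 -> affine_coord x y -> perp_map x = y.
Proof. by move=> /perp_mapP[h _]; exact: affine_coord_inj. Qed.

Lemma perp_map_perp x : '[x, e] = 0 -> '[perp_map x, e'] = 0.
Proof. by move=> /perp_mapP[[]]. Qed.

Lemma perp_map0 : perp_map 0 = 0.
Proof.
have [a _ e'a] := e'E; apply: perp_map_uniq; first exact: dot0l.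
by split; [exact: dot0l|exists a; rewrite !addr0].
Qed.

Lemma perp_map_neq0 x : '[x, e] = 0 -> x != 0 -> perp_map x != 0.
Proof.
move=> xe x0; apply/eqP => Lx; have [[_ [c E]] _] := perp_mapP xe.
have [a a0 e'a] := e'E; rewrite Lx addr0 e'a in E.
have : indep2 (phi e) (phi (e + x)).
  apply: phi_indep => u v.
  rewrite scalerDr addrA -scalerDl => /(affine_indep xe x0)[+ v0].
  by rewrite v0 addr0.
move=> /(_ a (- c))[|/eqP]; last by rewrite (negPf a0).
by rewrite E scaleNr subrr.
Qed.

Lemma phi_perp_map x : '[x, e] = 0 -> x != 0 ->
  exists2 b, b != 0 & perp_map x = b *: phi x.
Proof.
move=> xe x0; have [_ [b hb]] := perp_mapP xe; exists b => //.
by apply/eqP => b0; move: (perp_map_neq0 xe x0); rewrite hb b0 scale0r eqxx.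
Qed.

Lemma phi_affine x : '[x, e] = 0 ->
  exists2 b, b != 0 & e' + perp_map x = b *: phi (e + x).
Proof.
move=> xe; have [[ye [b hb]] _] := perp_mapP xe; exists b => //.
apply/eqP => b0; have : '[e' + perp_map x, e'] = 0
  by rewrite hb b0 scale0r dot0l.
rewrite dotDl ee' ye addr0.
by move/eqP; rewrite oner_eq0.
Qed.

Lemma perp_map_indep x y : '[x, e] = 0 -> '[y, e] = 0 -> indep2 x y ->
  indep2 (perp_map x) (perp_map y).
Proof.
move=> xe ye ixy.
have [b b0 ->] := phi_perp_map xe (indep2_neq0 ixy).
have [c c0 ->] := phi_perp_map ye (indep2_neq0 (indep2_sym ixy)).
exact/indep2Z/phi_indep.
Qed.

Lemma dotDe x y : '[x, e] = 0 -> '[y, e] = 0 -> '[x + y, e] = 0.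
Proof. by move=> xe ye; rewrite dotDl xe ye addr0. Qed.

Lemma dotZe a x : '[x, e] = 0 -> '[a *: x, e] = 0.
Proof. by move=> xe; rewrite dotZl xe mulr0. Qed.

(** e + x + y lies in the plane of e + x and y. *)
Lemma perp_mapD_half x y : '[x, e] = 0 -> '[y, e] = 0 -> indep2 x y ->
  exists a b, phi (e + (x + y)) = a *: (e' + perp_map x) + b *: perp_map y.
Proof.
move=> xe ye ixy.
have [b b0 Ey] := phi_perp_map ye (indep2_neq0 (indep2_sym ixy)).
have [c c0 Ex] := phi_affine xe.
have i2 : indep2 (e + x) y.
  move=> u v h; have u0 : u = 0.
    have := dot0l dot e; rewrite -h dotDl !dotZl dotDl ee xe ye mulr0 !addr0.
    by rewrite mulr1.
  by split=> //; have [|_ ->] := ixy 0 v; rewrite // scale0r -{2}h u0 scale0r.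
have := @phi_line _ _ 1 1 i2; rewrite !scale1r -addrA => -[|u [v ->]].
  exact/affine_neq0/dotDe.
by exists (u / c), (v / b); rewrite Ex Ey !scalerA !divfK.
Qed.

(** The image of the line of e + x + y lies in the plane of e' + L x and L y and
    in the plane of e' + L y and L x; these meet in the line of
    e' + L x + L y. *)
Lemma perp_mapD_indep x y : '[x, e] = 0 -> '[y, e] = 0 -> indep2 x y ->
  perp_map (x + y) = perp_map x + perp_map y.
Proof.
move=> xe ye ixy; have [a [b E]] := perp_mapD_half xe ye ixy.
have [c [d]] := perp_mapD_half ye xe (indep2_sym ixy);
  rewrite [y + x]addrC E => E'.
have ac : a = c.
  have : '[a *: (e' + perp_map x) + b *: perp_map y, e'] =
      '[c *: (e' + perp_map y) + d *: perp_map x, e'].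
    by rewrite E'.
  by rewrite !dotDl !dotZl !dotDl ee' !perp_map_perp// !mulr0 !addr0 !mulr1.
have [|ad bc] := @indep2_eq _ _ a b d c (perp_map_indep xe ye ixy).
  move: E'; rewrite -ac !scalerDr -!addrA => /addrI ->; exact: addrC.
have a0 : a != 0.
  apply/eqP => a0; move: (phi_neq0 (affine_neq0 (dotDe xe ye))).
  by rewrite E bc -ac a0 !scale0r addr0 eqxx.
apply: perp_map_uniq; first exact: dotDe.
split; first by rewrite dotDl !perp_map_perp// addr0.
by exists a^-1; rewrite E bc -ac -scalerDr scalerA mulVf// scale1r addrA.
Qed.

(** Proportional x and y are separated by a vector z orthogonal to them: expand
    L (x + y + z) in two ways. *)
Lemma perp_mapD x y : '[x, e] = 0 -> '[y, e] = 0 ->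
  perp_map (x + y) = perp_map x + perp_map y.
Proof.
move=> xe ye.
have [->|x0] := eqVneq x 0; first by rewrite perp_map0 !add0r.
have [->|y0] := eqVneq y 0; first by rewrite perp_map0 !addr0.
case: (pselect (indep2 x y)) => [|/(not_indep2 x0)[c yc]];
  first exact: perp_mapD_indep.
have [z zz [ze zx _]] := perp3 e x x.
have z0 : z != 0 by rewrite -(dnorm_eq0 dot) zz oner_eq0.
have iz w b : w = b *: x -> w != 0 -> indep2 w z.
  by move=> wb w0; apply: indep2_orth => //; apply: dot_sym0;
    rewrite wb dotZr zx mulr0.
have ixyz : indep2 x (y + z).
  move=> a b; rewrite scalerDr yc scalerA addrA -scalerDl => h.
  have b0 : b = 0.
    have := dot0l dot z; rewrite -h dotDl !dotZl zz (dot_sym0 zx) mulr0 add0r.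
    by rewrite mulr1.
  move: h; rewrite b0 mul0r scale0r !addr0 => /eqP.
  by rewrite scaler_eq0 (negPf x0) orbF => /eqP.
have E : perp_map (x + y + z) = perp_map x + perp_map y + perp_map z.
  rewrite -addrA perp_mapD_indep//; last exact: dotDe.
  by rewrite (perp_mapD_indep ye ze (iz _ _ yc y0)) addrA.
have [xy0|xy0] := eqVneq (x + y) 0.
  by move: E; rewrite xy0 add0r perp_map0 -{1}[perp_map z]add0r => /addIr.
apply: (addIr (perp_map z)); rewrite -E (perp_mapD_indep (dotDe xe ye) ze)//.
by apply: (iz _ (1 + c)) => //; rewrite scalerDl scale1r yc.
Qed.

Lemma perp_mapZ_ex a x : '[x, e] = 0 -> x != 0 ->
  exists s, perp_map (a *: x) = s *: perp_map x.
Proof.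
move=> xe x0; have [->|a0] := eqVneq a 0.
  by exists 0; rewrite !scale0r perp_map0.
have ax0 : a *: x != 0 by rewrite scaler_eq0 negb_or a0.
have [b b0 ->] := phi_perp_map (dotZe a xe) ax0.
have [c c0 ->] := phi_perp_map xe x0; have [d ->] := phiZ x0 a0.
by exists (b * d / c); rewrite !scalerA divfK.
Qed.

(** Compare the coefficients of L x and L y in L (a (x + y)). *)
Lemma perp_mapZ_same a x y s t : '[x, e] = 0 -> '[y, e] = 0 -> indep2 x y ->
  perp_map (a *: x) = s *: perp_map x -> perp_map (a *: y) = t *: perp_map y ->
    s = t.
Proof.
move=> xe ye ixy hs ht; have xye := dotDe xe ye.
have xy0 : x + y != 0.
  apply/eqP => h; have [|/eqP] := ixy 1 1; last by rewrite oner_eq0.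
  by rewrite !scale1r.
have [r] := perp_mapZ_ex a xye xy0; rewrite scalerDr !perp_mapD//;
  [|exact: dotZe..].
by rewrite hs ht scalerDr => /(indep2_eq (perp_map_indep xe ye ixy))[-> ->].
Qed.

Variable u : H.
Hypotheses (ue : '[u, e] = 0) (uu : '[u, u] = 1).

Let u0 : u != 0.
Proof. by rewrite -(dnorm_eq0 dot) uu oner_eq0. Qed.

(** The scalar belonging to a at u; by [perp_mapZ] it is the same elsewhere. *)
Definition scalar_map a : C := projT1 (cid (perp_mapZ_ex a ue u0)).

(** A vector orthogonal to both x and u compares their scalars. *)
Lemma perp_mapZ a x : '[x, e] = 0 ->
  perp_map (a *: x) = scalar_map a *: perp_map x.
Proof.
move=> xe; have [->|x0] := eqVneq x 0;
  first by rewrite !scaler0 perp_map0 scaler0.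
have [w ww [we wx wu]] := perp3 e x u.
have w0 : w != 0 by rewrite -(dnorm_eq0 dot) ww oner_eq0.
have [s hs] := perp_mapZ_ex a xe x0; have [t ht] := perp_mapZ_ex a we w0.
have iwx : indep2 w x by exact: indep2_orth.
have iwu : indep2 w u by exact: indep2_orth.
rewrite hs -(perp_mapZ_same we xe iwx ht hs); congr (_ *: _).
by apply: (perp_mapZ_same we ue iwu ht); rewrite /scalar_map; case: cid.
Qed.

Let scalar_map_u a b : scalar_map a *: perp_map u = b *: perp_map u ->
  scalar_map a = b.
Proof.
move=> /eqP; rewrite -subr_eq0 -scalerBl scaler_eq0.
rewrite (negPf (perp_map_neq0 ue u0)) orbF.
by rewrite subr_eq0 => /eqP.
Qed.

Lemma scalar_mapD a b : scalar_map (a + b) = scalar_map a + scalar_map b.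
Proof.
apply: scalar_map_u; rewrite -perp_mapZ// !scalerDl perp_mapD ?perp_mapZ//;
  exact: dotZe.
Qed.

Lemma scalar_mapM a b : scalar_map (a * b) = scalar_map a * scalar_map b.
Proof.
apply: scalar_map_u; rewrite -perp_mapZ// -!scalerA !perp_mapZ//; exact: dotZe.
Qed.

Lemma scalar_map1 : scalar_map 1 = 1.
Proof. by apply: scalar_map_u; rewrite -perp_mapZ// !scale1r. Qed.

Lemma scalar_map0 : scalar_map 0 = 0.
Proof. by apply: (addIr (scalar_map 0)); rewrite -scalar_mapD !add0r. Qed.

Lemma scalar_mapN a : scalar_map (- a) = - scalar_map a.
Proof. by apply/eqP; rewrite -addr_eq0 -scalar_mapD addNr scalar_map0. Qed.

Lemma scalar_mapV a : a != 0 -> scalar_map a^-1 = (scalar_map a)^-1.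
Proof.
move=> a0; have h : scalar_map a * scalar_map a^-1 = 1
  by rewrite -scalar_mapM mulfV// scalar_map1.
have sa0 : scalar_map a != 0.
  by apply/eqP => s0; move: h; rewrite s0 mul0r => /eqP;
    rewrite eq_sym oner_eq0.
by apply: (mulfI sa0); rewrite h mulfV.
Qed.

(** The hypothesis says that e + x and e + y are orthogonal. *)
Lemma perp_map_dotN1 x y : '[x, e] = 0 -> '[y, e] = 0 -> '[x, y] = -1 ->
  '[perp_map x, perp_map y] = -1.
Proof.
move=> xe ye xy; have [b _ hx] := phi_affine xe; have [c _ hy] := phi_affine ye.
have : '[e' + perp_map x, e' + perp_map y] = 0.
  rewrite hx hy dotZl dotZr phi_orth ?mulr0//; [exact: affine_neq0..|].
  by rewrite dotDl !dotDr ee (dot_sym0 ye) xe xy addr0 add0r subrr.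
rewrite dotDl !dotDr ee' (dot_sym0 (perp_map_perp ye)) (perp_map_perp xe) addr0
  add0r.
by move/eqP; rewrite addrC addr_eq0 => /eqP.
Qed.

Lemma perp_map_norm_u : '[perp_map u, perp_map u] = 1.
Proof.
have := @perp_map_dotN1 u (-1 *: u) ue (dotZe _ ue).
rewrite perp_mapZ// !dotZr uu scalar_mapN scalar_map1 rmorphN rmorph1 mulr1
  mulN1r => /(_ erefl).
by move/oppr_inj.
Qed.

Let conjNV (a : C) : (- a^-1)^* = - (a^*)^-1.
Proof. by rewrite rmorphN fmorphV. Qed.

(** The vectors z u and - u / z^* have inner product -1. *)
Lemma scalar_map_conj z : scalar_map z^* = (scalar_map z)^*.
Proof.
have [->|z0] := eqVneq z 0; first by rewrite conjC0 scalar_map0 conjC0.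
have zc0 : z^* != 0 by rewrite conjC_eq0.
have := @perp_map_dotN1 (z *: u) (- (z^*)^-1 *: u) (dotZe _ ue) (dotZe _ ue).
rewrite !perp_mapZ// !dotZl !dotZr uu perp_map_norm_u !mulr1 scalar_mapN
  scalar_mapV//.
rewrite !conjNV conjCK mulrN mulfV// => /(_ erefl).
rewrite mulrN => /oppr_inj h.
have s0 : (scalar_map z^*)^* != 0.
  by apply/eqP => s0; move: h; rewrite s0 invr0 mulr0 => /eqP;
    rewrite eq_sym oner_eq0.
have E : scalar_map z = (scalar_map z^*)^* by apply: (mulIf (invr_neq0 s0));
  rewrite h mulfV.
by rewrite E conjCK.
Qed.

(** Apply [perp_map_dotN1] to x and - x / '[x, x]. *)
Lemma perp_map_norm x : '[x, e] = 0 ->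
  '[perp_map x, perp_map x] = scalar_map '[x, x].
Proof.
move=> xe; have [->|x0] := eqVneq x 0;
  first by rewrite perp_map0 !dot0l scalar_map0.
have xx0 : '[x, x] != 0 by rewrite dnorm_eq0.
have xr : '[x, x]^* = '[x, x] by rewrite -dotC.
have := @perp_map_dotN1 x (- '[x, x]^-1 *: x) xe (dotZe _ xe).
rewrite perp_mapZ// !dotZr scalar_mapN scalar_mapV// !conjNV -scalar_map_conj
  xr mulNr mulVf//.
move=> /(_ erefl); rewrite mulNr => /oppr_inj.
move=> h; have s0 : scalar_map '[x, x] != 0.
  by apply/eqP => s0; move: h; rewrite s0 invr0 mul0r => /eqP;
    rewrite eq_sym oner_eq0.
by apply: (mulfI (invr_neq0 s0)); rewrite h mulVf.
Qed.

Definition full_map v : H :=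
  scalar_map '[v, e] *: e' + perp_map (v - '[v, e] *: e).

Let perp_e v : '[v - '[v, e] *: e, e] = 0.
Proof. by rewrite dotBl dotZl ee mulr1 subrr. Qed.

Lemma full_map_semilinear a x y :
  full_map (a *: x + y) = scalar_map a *: full_map x + full_map y.
Proof.
have E : a *: x + y - '[a *: x + y, e] *: e =
    a *: (x - '[x, e] *: e) + (y - '[y, e] *: e).
  by rewrite dotDl dotZl scalerDl scalerBr opprD addrACA scalerA.
rewrite /full_map E (perp_mapD (dotZe a (perp_e x)) (perp_e y))
  (perp_mapZ a (perp_e x)).
by rewrite dotDl dotZl scalar_mapD scalar_mapM scalerDl scalerDr -scalerA
  addrACA.
Qed.

Lemma full_map_norm x : '[full_map x, full_map x] = scalar_map '[x, x].
Proof.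
have Lp := perp_map_perp (perp_e x).
rewrite {1 2}/full_map dotDl !dotDr !dotZl !dotZr ee' mulr1 Lp (dot_sym0 Lp)
  !mulr0.
rewrite addr0 add0r perp_map_norm// -scalar_map_conj -scalar_mapM -scalar_mapD;
  congr scalar_map.
have pyth a w : '[w, e] = 0 -> '[w + a *: e, w + a *: e] = a * a^* + '[w, w].
  move=> we; rewrite dotDl !dotDr !dotZl !dotZr ee mulr1 we (dot_sym0 we)
    !mulr0.
  by rewrite addr0 add0r addrC.
by rewrite -pyth// subrK.
Qed.

Lemma full_map_phi x : x != 0 -> exists c, full_map x = c *: phi x.
Proof.
move=> x0; rewrite /full_map; set w := x - _; set a := '[x, e].
have we : '[w, e] = 0 by exact: perp_e.
have xE : x = a *: e + w by rewrite /w addrC subrK.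
have [a0|a0] := eqVneq a 0.
  have [_ [b ->]] := perp_mapP we.
  by exists b; rewrite a0 scalar_map0 scale0r add0r xE a0 scale0r add0r.
have awe := dotZe a^-1 we.
have [b b0 hb] := phi_affine awe.
have [d hd] := phiZ (affine_neq0 awe) a0.
have {}hd : phi x = d *: phi (e + a^-1 *: w).
  by rewrite -hd scalerDr scalerA mulfV// scale1r -xE.
have d0 : d != 0.
  by apply/eqP => d0; move: (phi_neq0 x0); rewrite hd d0 scale0r eqxx.
exists (scalar_map a * b / d);
  rewrite hd !scalerA divfK// -scalerA -hb scalerDr.
by rewrite -perp_mapZ// scalerA mulfV// scale1r.
Qed.

Lemma full_map_ex : exists (s : C -> C) (L : H -> H),
    [/\ forall a b, s (a + b) = s a + s b, forall a b, s (a * b) = s a * s b,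
        s 1 = 1 & forall a, s a^* = (s a)^*] /\
    [/\ forall a x y, L (a *: x + y) = s a *: L x + L y,
        forall x, '[L x, L x] = s '[x, x] &
        forall x, x != 0 -> exists c, L x = c *: phi x].
Proof.
exists scalar_map, full_map; split; split.
- exact: scalar_mapD.
- exact: scalar_mapM.
- exact: scalar_map1.
- exact: scalar_map_conj.
- exact: full_map_semilinear.
- exact: full_map_norm.
- exact: full_map_phi.
Qed.

End Construction.

Lemma semilinear_representative (phi : H -> H) :
  (forall x, x != 0 -> phi x != 0) ->
  (forall x y, x != 0 -> y != 0 -> '[x, y] = 0 -> '[phi x, phi y] = 0) ->
  (forall a x, x != 0 -> a != 0 -> exists b, phi (a *: x) = b *: phi x) ->
  (forall x y, indep2 x y -> indep2 (phi x) (phi y)) ->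
  (forall x y a b, indep2 x y -> a *: x + b *: y != 0 ->
     exists c d, phi (a *: x + b *: y) = c *: phi x + d *: phi y) ->
  dim_gt H 3 ->
  exists (s : C -> C) (L : H -> H),
    [/\ forall a b, s (a + b) = s a + s b, forall a b, s (a * b) = s a * s b,
        s 1 = 1 & forall a, s a^* = (s a)^*] /\
    [/\ forall a x y, L (a *: x + y) = s a *: L x + L y,
        forall x, '[L x, L x] = s '[x, x] &
        forall x, x != 0 -> exists c, L x = c *: phi x].
Proof.
move=> h1 h2 h3 h4 h5 dH.
have p3 x y z : exists2 w, '[w, w] = 1 &
    [/\ '[w, x] = 0, '[w, y] = 0 & '[w, z] = 0].
  have [//|w ww h] := @dim_gt_perp _ _ dot _ [:: x; y; z] dH.
  by exists w => //; split; apply: h; rewrite !inE eqxx ?orbT.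
have [e ee _] := p3 0 0 0; have [u uu [ue _ _]] := p3 e e e.
have e0 : e != 0 by rewrite -(dnorm_eq0 dot) ee oner_eq0.
have [a a0 ee'] := unit_scale dot (h1 _ e0).
have e'E : exists2 b, b != 0 & a *: phi e = b *: phi e by exists a.
by apply: (@full_map_ex phi _ _ _ _ _ p3 e (a *: phi e) ee ee' e'E u ue uu).
Qed.

End Wigner.

(** * Endomorphisms of the complex numbers that commute with conjugation *)

Section ComplexEndomorphism.
Variable R : realType.
Implicit Types z : R[i].

(** Commuting with conjugation, s preserves the reals; preserving squares, it is
    monotone on them, and it fixes the natural numbers. The Archimedean property
    then makes s the identity on the reals. *)
Lemma complex_endo_id_or_conj (s : R[i] -> R[i]) :
  (forall a b, s (a + b) = s a + s b) -> (forall a b, s (a * b) = s a * s b) ->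
  s 1 = 1 -> (forall a, s a^* = (s a)^*) ->
  s =1 id \/ s =1 Num.conj.
Proof.
move=> sD sM s1 sC.
have s0 : s 0 = 0 by apply: (addIr (s 0)); rewrite -sD !add0r.
have sN a : s (- a) = - s a by apply/eqP; rewrite -addr_eq0 -sD addNr s0.
have sMn a n : s (a *+ n) = s a *+ n.
  by elim: n => [|n IH]; rewrite ?s0// !mulrS sD IH.
have sreal z : z \is Num.real -> s z \is Num.real.
  by rewrite !CrealE -sC => /eqP ->.
have spos z : 0 <= z -> 0 <= s z.
  move=> z0; rewrite -[z]sqrtCK expr2 sM -expr2 -realEsqr; apply: sreal.
  by apply: ger0_real; rewrite sqrtC_ge0.
have smono x y : x <= y -> s x <= s y.
  by rewrite -subr_ge0 => /spos; rewrite sD sN subr_ge0.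
have sposE r : 0 <= r -> s r%:C%C = r%:C%C.
  move=> r0.
  have [t st] : exists t : R, s r%:C%C = t%:C%C.
    by apply/complex_realP/sreal/complex_realP; exists r.
  rewrite st; congr (_%:C)%C; apply/eqP; apply: contrapT => /negP tr.
  have d0 : 0 < `|t - r| by rewrite normr_gt0 subr_eq0.
  pose n := (Num.truncn `|t - r|^-1).+1.
  have hn : 1 < `|t - r| *+ n.
    rewrite -mulr_natr mulrC -ltr_pdivrMr// mul1r.
    have : 0 <= `|t - r|^-1 by rewrite invr_ge0.
    by move=> /truncn_itv/andP[].
  have rn0 : 0 <= r *+ n by exact: mulrn_wge0.
  have /andP[m1 m2] := truncn_itv rn0; set m := Num.truncn _ in m1 m2.
  have natC k : s (k%:R)%:C%C = (k%:R)%:C%C.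
    by rewrite rmorph_nat sMn s1.
  have sn : s (r *+ n)%:C%C = (t *+ n)%:C%C by rewrite !rmorphMn /= sMn st.
  have := smono (m%:R)%:C%C (r *+ n)%:C%C; rewrite sn natC !lecR => /(_ m1) k1.
  have := smono (r *+ n)%:C%C (m.+1%:R)%:C%C.
  rewrite sn natC !lecR => /(_ (ltW m2)) k2.
  (* n t and n r lie in the same interval between consecutive integers. *)
  have : `|t - r| *+ n <= 1.
    rewrite -normrMn mulrnBl ler_norml; apply/andP; split.
      by move: m2 k1; rewrite -natr1; lra.
    by move: m1 k2; rewrite -natr1; lra.
  by rewrite leNgt hn.
have sR r : s r%:C%C = r%:C%C.
  have [/sposE//|/ltW r0] := leP 0 r.
  by rewrite -[r]opprK rmorphN /= sN sposE// oppr_ge0.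
have zE z : s z = (complex.Re z)%:C%C + s 'i * (complex.Im z)%:C%C.
  by rewrite {1}[z]complexE sD sM !sR.
have : s 'i ^+ 2 = 'i ^+ 2 by rewrite expr2 -sM -expr2 sqrCi sN s1.
move/eqP; rewrite eqf_sqr => /orP[]/eqP si; [left|right] => z.
  by rewrite zE si [RHS]complexE.
have cr (k : R) : (k%:C%C)^* = k%:C%C by apply/CrealP/complex_realP; exists k.
rewrite zE si {3}[z]complexE rmorphD rmorphM /= !cr; congr (_ + _ * _).
by rewrite -conjCi.
Qed.

End ComplexEndomorphism.

(** * From subspaces to lines and back *)

Section Reconstruction.
Context {C : numClosedFieldType} {H : lmodType C}.
Variable dot : {dot H for Num.conj}.
Local Notation "''[' x , y ]" := (dot x y).
Local Notation orthonormal := (orthonormal dot).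
Implicit Types (s t : seq H) (e p q r : H).
Local Notation ospan := (ospan dot).

Definition line (x : H) : set H := lspan (fun _ : 'I_1 => x).

Lemma lineP x y : line x y <-> exists a, y = a *: x.
Proof.
split=> [[a ->]|[a ->]]; first by exists (a ord0); rewrite big_ord1.
by exists (fun=> a); rewrite big_ord1.
Qed.

Lemma line_dim x : x != 0 -> has_dim 1 (line x).
Proof.
move=> x0; exists (fun=> x) => // a; rewrite big_ord1 => /eqP.
by rewrite scaler_eq0 (negPf x0) orbF => /eqP a0 i; rewrite ord1.
Qed.

Lemma line_sub (X : set H) x : submod X -> X x -> line x `<=` X.
Proof. by move=> sX Xx y /lineP[a ->]; exact: submodZ. Qed.

Lemma lineZ a x : a != 0 -> line (a *: x) = line x.
Proof.
move=> a0; apply/seteqP; split=> y /lineP[b ->]; apply/lineP.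
  by exists (b * a); rewrite scalerA.
by exists (b / a); rewrite scalerA divfK.
Qed.

Lemma dim1_line (P : set H) : has_dim 1 P ->
  exists2 y, '[y, y] = 1 & P = line y.
Proof.
move=> /(has_dimP dot)[t [ont st ->]]; case: t ont st => [|y []]//= ony _.
have /orthonormal_cons[yy _ _] := ony; exists y => //.
rewrite (ospan_lspan ony) /line; congr lspan.
by apply/funext => i; rewrite ord1.
Qed.

Definition plane (x y : H) : set H := lspan (fun i : 'I_2 => [:: x; y]`_i).

Lemma planeP x y z : plane x y z <-> exists a b, z = a *: x + b *: y.
Proof.
split=> [[a ->]|[a [b ->]]].
  by exists (a ord0), (a (lift ord0 ord0)); rewrite big_ord_recl big_ord1.
by exists (fun i => [:: a; b]`_i); rewrite big_ord_recl big_ord1.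
Qed.

Lemma plane_dim x y : indep2 x y -> has_dim 2 (plane x y).
Proof.
move=> ixy; eexists; last reflexivity.
move=> a; rewrite big_ord_recl big_ord1 /= => /ixy[a0 a1] i.
by case: (unliftP ord0 i) => [j ->|-> //]; rewrite ord1.
Qed.

Lemma plane_sub (X : set H) x y : submod X -> X x -> X y -> plane x y `<=` X.
Proof.
by move=> sX Xx Xy z /planeP[a [b ->]]; apply: submodD => //; exact: submodZ.
Qed.

Lemma plane_eq (X : set H) x y : has_dim 2 X -> X x -> X y -> indep2 x y ->
  X = plane x y.
Proof.
move=> dX Xx Xy /plane_dim/(has_dimP dot)[t [ont st E]].
rewrite E; apply: (has_dim_eq dX ont) => //; rewrite -E.
by apply: plane_sub => //; exact: has_dim_submod dX.
Qed.

Lemma ospan_cap p q s : orthonormal (p :: s) -> orthonormal (q :: s) ->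
  indep2 p q ->
  ospan (p :: s) `&` ospan (q :: s) = ospan s.
Proof.
move=> onp onq ipq; have /orthonormal_cons[pp ps ons] := onp.
have /orthonormal_cons[qq qs _] := onq.
apply/seteqP; split=> y; last first.
  by move=> sy; split; apply: ospan_sub_mem sy => // e es;
    rewrite in_cons es orbT.
rewrite /ospan /= /oproj !big_cons -!/(oproj _ _ _) => -[yp yq].
have : '[y, p] *: p + (- '[y, q]) *: q = 0.
  by rewrite scaleNr; apply/eqP; rewrite subr_eq0;
    apply/eqP/(addIr (oproj dot s y)); rewrite yp yq.
by move=> /ipq[p0 _]; rewrite -{2}yp p0 scale0r add0r.
Qed.

Lemma ospan_line_perp p s : orthonormal (p :: s) ->
  ospan (p :: s) `&` ortho_compl dot (ospan s) = ospan [:: p].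
Proof.
move=> onp; have /orthonormal_cons[pp ps ons] := onp.
apply/seteqP; split=> y.
  move=> [+ ys]; rewrite /ospan /= /oproj big_cons big_seq1 => {2}<-.
  rewrite big1_seq ?addr0// => e /andP[_ es].
  by rewrite ys ?scale0r//; exact: ospan_mem.
move=> yp; split; first by apply: ospan_sub_mem yp => // e;
  rewrite inE => /eqP ->; rewrite mem_head.
move=> z sz; apply: dot_sym0; apply: orth_ospan yp => e; rewrite inE => /eqP ->.
by apply: dot_sym0; apply: orth_ospan sz.
Qed.

Lemma orthonormal_neq0 s x : orthonormal s -> x \in s -> x != 0.
Proof.
move=> /orthonormalP[us h] xs; rewrite -(dnorm_eq0 dot) h// eqxx;
  exact: oner_neq0.
Qed.

Lemma has_dim_uniq (X : set H) m n : has_dim m X -> has_dim n X -> m = n.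
Proof.
move=> /(has_dimP dot)[s [ons <- ->]] /(has_dimP dot)[t [ont <- E]].
by apply/eqP; rewrite eqn_leq !(ospan_leq (dot := dot))// E.
Qed.

(** The separation hypothesis makes the map of lines injective: if x and y had
    proportional images, then adding k+1 vectors orthogonal to both would give
    two adjacent subspaces with the same image. Surjectivity of s is what makes
    the image of X under L a subspace. *)
Lemma admissible_semilinear k F : admissible dot k.+2 F ->
  dim_gt H (2 * k.+2) ->
  (forall X Y, has_dim k.+2 X -> has_dim k.+2 Y -> has_dim k.+1 (X `&` Y) ->
     F X <> F Y) ->
  exists (s : C -> C) (L : H -> H),
    [/\ forall a b, s (a + b) = s a + s b, forall a b, s (a * b) = s a * s b,
        s 1 = 1 & forall a, s a^* = (s a)^*] /\
    [/\ forall a x y, L (a *: x + y) = s a *: L x + L y,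
        forall x, '[L x, L x] = s '[x, x] &
        (forall a, exists b, s b = a) ->
        forall X, has_dim k.+2 X -> F X = L @` X].
Proof.
move=> gF dH neqF; have [Phi [F2 [g1 g2 h2 hF]]] := descend_to_lines gF dH.
have [d1 o1 _] := g1; have [d2 _ _] := g2; have [dF _ _] := gF.
have /choice[phi phiP] : forall x, exists y, x != 0 ->
    '[y, y] = 1 /\ Phi (line x) = line y.
  move=> x; have [->|x0] := eqVneq x 0; first by exists 0.
  by have [y yy E] := dim1_line (d1 _ (line_dim x0)); exists y.
have phi_mem x : x != 0 -> Phi (line x) (phi x).
  by move=> /phiP[_ ->]; apply/lineP; exists 1; rewrite scale1r.
have phi_orth x y : x != 0 -> y != 0 -> '[x, y] = 0 -> '[phi x, phi y] = 0.
  move=> x0 y0 xy; apply: (o1 (line x) (line y)).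
  - exact: line_dim.
  - exact: line_dim.
  - by move=> _ _ /lineP[a ->] /lineP[b ->]; rewrite dotZl dotZr xy !mulr0.
  - exact: phi_mem.
  - exact: phi_mem.
have phi_neq0 x : x != 0 -> phi x != 0.
  by move=> /phiP[h _]; rewrite -(dnorm_eq0 dot) h oner_eq0.
have on_phi t : orthonormal t -> orthonormal (map phi t).
  elim: t => //= x t IH ont; have /orthonormal_cons[xx xt ont'] := ont.
  have x0 : x != 0 by apply: (orthonormal_neq0 ont); rewrite mem_head.
  apply/orthonormal_cons; split; [by case: (phiP _ x0)| |exact: IH].
  move=> _ /mapP[y yt ->]; apply: phi_orth => //; last exact: xt.
  exact: orthonormal_neq0 yt.
have F_mem X x : has_dim k.+2 X -> x != 0 -> X x -> F X (phi x).
  move=> dX x0 Xx; apply: (hF (line x)) => //; last exact: phi_mem.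
    exact: line_dim.
  by apply: line_sub => //; exact: has_dim_submod dX.
have F_ospan X t : has_dim k.+2 X -> orthonormal t -> size t = k.+2 ->
    {in t, forall x, F X (phi x)} -> F X = ospan (map phi t).
  move=> dX ont st ht; apply: (has_dim_eq (dF _ dX)).
  - exact: on_phi.
  - apply: ospan_sub => [|_ /mapP[y yt ->]];
    first exact: has_dim_submod (dF _ dX).
    exact: ht.
  - by rewrite size_map.
have phi_indep x y : indep2 x y -> indep2 (phi x) (phi y).
  move=> ixy; have x0 := indep2_neq0 ixy;
    have y0 := indep2_neq0 (indep2_sym ixy).
  apply: contrapT => /(not_indep2 (phi_neq0 _ x0))[a ya].
  have /(has_dimP dot)[t [ont st E]] := plane_dim ixy.
  have [|s [ss onst]] := @orthonormal_extend _ _ dot _ k.+1 t dH _ ont;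
    first by lia.
  have ons : orthonormal s by part_of onst.
  have sP z : plane x y z -> {in s, forall e, '[z, e] = 0}.
    rewrite E => tz e es; apply: dot_sym0.
    by apply: (orthonormal_cat_orth onst) => //; exact: ospan_mem.
  have [b b0 bx] := unit_scale dot x0; have [c c0 cy] := unit_scale dot y0.
  have onx : orthonormal (b *: x :: s).
    apply/orthonormal_cons; split=> // e es; apply: sP es.
    by apply/planeP; exists b, 0; rewrite scale0r addr0.
  have ony : orthonormal (c *: y :: s).
    apply/orthonormal_cons; split=> // e es; apply: sP es.
    by apply/planeP; exists 0, c; rewrite scale0r add0r.
  have dX : has_dim k.+2 (ospan (b *: x :: s)) by rewrite -ss;
    exact: has_dim_ospan onx.
  have dY : has_dim k.+2 (ospan (c *: y :: s)) by rewrite -ss;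
    exact: has_dim_ospan ony.
  apply: (neqF _ _ dX dY).
    rewrite ospan_cap//; last exact: indep2Z.
    by rewrite -ss; exact: has_dim_ospan.
  have lineE : Phi (line (b *: x)) = Phi (line (c *: y)).
    rewrite !lineZ// (phiP _ x0).2 (phiP _ y0).2 ya lineZ//.
    by apply/eqP => a0; have := phi_neq0 _ y0; rewrite ya a0 scale0r eqxx.
  have bx0 : b *: x != 0 by apply: (orthonormal_neq0 onx); rewrite mem_head.
  have cy0 : c *: y != 0 by apply: (orthonormal_neq0 ony); rewrite mem_head.
  (* The image of the line of b x is also that of c y, so both images contain
     the lines belonging to the vectors b x and s, which span them. *)
  have sFX e : e \in b *: x :: s -> F (ospan (b *: x :: s)) (phi e).
    by move=> es; apply: F_mem => //;
      [exact: orthonormal_neq0 es|exact: ospan_mem].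
  have sFY e : e \in b *: x :: s -> F (ospan (c *: y :: s)) (phi e).
    rewrite in_cons => /orP[/eqP->|es].
      apply: (hF (line (c *: y))) => //; first exact: line_dim.
        apply: line_sub; first exact: submod_ospan.
        by apply: ospan_mem => //; rewrite mem_head.
      by rewrite -lineE; exact: phi_mem.
    apply: F_mem => //; first exact: orthonormal_neq0 es.
    by apply: ospan_mem => //; rewrite in_cons es orbT.
  have sz : size (b *: x :: s) = k.+2 by rewrite /= ss.
  by rewrite (F_ospan _ _ dX onx sz sFX) (F_ospan _ _ dY onx sz sFY).
have [|||s [L [sP [LP Ln Lphi]]]] := semilinear_representative phi_neq0
  phi_orth _ phi_indep.
- move=> a x x0 a0; apply/lineP; rewrite -(phiP _ x0).2 -(lineZ _ a0).
  by apply: phi_mem; rewrite scaler_eq0 negb_or a0.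
- move=> x y a b ixy z0.
  have x0 := indep2_neq0 ixy; have y0 := indep2_neq0 (indep2_sym ixy).
  have F2mem z : z != 0 -> plane x y z -> F2 (plane x y) (phi z).
    move=> z0' zP; apply: (h2 (line z)).
    - exact: line_dim.
    - exact: plane_dim.
    - by apply: line_sub => //; exact: lspan_submod.
    - exact: phi_mem.
  apply/planeP; rewrite -(@plane_eq (F2 (plane x y))).
  + by apply: F2mem => //; apply/planeP; exists a, b.
  + exact/d2/plane_dim.
  + by apply: F2mem => //; apply/planeP; exists 1, 0;
    rewrite scale1r scale0r addr0.
  + by apply: F2mem => //; apply/planeP; exists 0, 1;
    rewrite scale1r scale0r add0r.
  + exact: phi_indep.
- by apply: dim_gt_leq dot _ _ _ dH; lia.
exists s, L; split=> //; split=> // s_surj X dX.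
have [sD _ s1 _] := sP.
have LD x y : L (x + y) = L x + L y by rewrite -{1}[x]scale1r LP s1 scale1r.
have L0 : L 0 = 0 by apply: (addIr (L 0)); rewrite -LD !add0r.
have LZ a x : L (a *: x) = s a *: L x by rewrite -[a *: x]addr0 LP L0 addr0.
have /(has_dimP dot)[t [ont st XE]] := dX.
have FE : F X = ospan (map phi t).
  apply: F_ospan => // x xt; apply: F_mem => //;
    first exact: orthonormal_neq0 xt.
  by rewrite XE; exact: ospan_mem.
have Le e : e \in t -> exists2 c, c != 0 & L e = c *: phi e.
  move=> et; have [c ce] := Lphi _ (orthonormal_neq0 ont et); exists c => //.
  apply/eqP => c0; have := Ln e; rewrite ce c0 scale0r dot0l.
  have /orthonormalP[_ ->] := ont; rewrite ?eqxx// s1 => /eqP.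
  by rewrite eq_sym oner_eq0.
rewrite FE XE; apply/seteqP; split.
  apply: ospan_sub.
    split; first by exists 0 => //; case: (submod_ospan dot t).
    move=> a _ _ [x tx <-] [y ty <-]; have [b <-] := s_surj a.
    by exists (b *: x + y); [case: (submod_ospan dot t) => _; apply|rewrite LP].
  move=> _ /mapP[e et ->]; have [c c0 Lc] := Le _ et;
    have [b bc] := s_surj c^-1.
  exists (b *: e); first by apply: submodZ;
    [exact: submod_ospan|exact: ospan_mem].
  by rewrite LZ bc Lc scalerA mulVf// scale1r.
move=> _ [y ty <-]; rewrite -ty /oproj (big_morph L LD L0).
apply: submod_sum => [|e et]; first exact: submod_ospan.
rewrite LZ; apply: submodZ; first exact: submod_ospan.
have [c _ ->] := Le _ et; apply: submodZ; first exact: submod_ospan.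
by apply: ospan_mem; [exact: on_phi|exact: map_f].
Qed.

End Reconstruction.

(** * Transformations of the Grassmannian *)

Section OnSets.
Context {C : numClosedFieldType} {H : lmodType C} {k : nat}.

Definition on_sets (f : grassmannian H k -> grassmannian H k) (X : set H) :
    set H :=
  if pselect (has_dim k X) is left dX then f (Grassmannian dX) else set0.

Lemma gr_inj (X Y : grassmannian H k) : X = Y :> set H -> X = Y.
Proof.
case: X Y => X dX [Y dY] /= XY; rewrite XY in dX *.
by congr Grassmannian; exact: Prop_irrelevance.
Qed.

Lemma on_setsE f X (dX : has_dim k X) : on_sets f X = f (Grassmannian dX).
Proof.
by rewrite /on_sets; case: pselect => // dX'; congr (gr_set (f _));
  exact: gr_inj.
Qed.

End OnSets.

Section Transformation.
Context {C : numClosedFieldType} {H : lmodType C} {k : nat}.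
Variable dot : {dot H for Num.conj}.
Variable f : grassmannian H k.+1 -> grassmannian H k.+1.
Hypothesis f_orth : {homo f : X Y / gr_orthogonal dot X Y}.
Hypothesis f_adj : {homo f : X Y / adjacent X Y} \/
  injective f /\ {homo f : X Y / ortho_adjacent dot X Y}.

(** Subspaces differing in one vector of an orthonormal basis are
    ortho-adjacent, so their images are adjacent under either condition. *)
Lemma admissible_on_sets : admissible dot k.+1 (on_sets f).
Proof.
split.
- by move=> X dX; rewrite on_setsE; exact: gr_dim.
- by move=> X Y dX dY XY; rewrite !on_setsE; exact: f_orth.
move=> p q s onpq [ss].
have onp : orthonormal dot (p :: s) by part_of onpq.
have onq : orthonormal dot (q :: s) by part_of onpq.
have onpq' : orthonormal dot ([:: p] ++ [:: q]) by part_of onpq.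
have ipq : indep2 p q.
  apply: (@indep2_orth _ _ dot).
  - by apply: (orthonormal_neq0 onp); rewrite mem_head.
  - by apply: (orthonormal_neq0 onq); rewrite mem_head.
  - by have /orthonormal_cons[_ + _] := onpq; apply; rewrite mem_head.
have dX : has_dim k.+1 (ospan dot (p :: s)) by rewrite -ss;
  exact: has_dim_ospan onp.
have dY : has_dim k.+1 (ospan dot (q :: s)) by rewrite -ss;
  exact: has_dim_ospan onq.
rewrite !on_setsE; set X := Grassmannian dX; set Y := Grassmannian dY.
have capE : (X : set H) `&` Y = ospan dot s by exact: ospan_cap.
have adjXY : adjacent X Y.
  by rewrite /adjacent capE -ss; apply: has_dim_ospan; part_of onp.
have fXY : adjacent (f X) (f Y).
  case: f_adj => [|[_ /(_ X Y)[]//]]; first exact.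
  have onp1 : orthonormal dot [:: p] by part_of onp.
  have onq1 : orthonormal dot [:: q] by part_of onq.
  rewrite /ortho_adjacent /= -/(X `&` Y) capE !ospan_line_perp//; split=> //.
  - exact: has_dim_ospan onp1.
  - exact: has_dim_ospan onq1.
  - exact: orthonormal_cat_orth.
have [|c hc] := hyperplane_normal dot (gr_dim (f X)) fXY; first by move=> y [].
by exists c => y fy /(hc _ fy)[].
Qed.

(** Under (A) equal images would be adjacent to themselves; under (OA) this is
    injectivity. *)
Lemma on_sets_separates X Y : has_dim k.+1 X -> has_dim k.+1 Y ->
  has_dim k (X `&` Y) -> on_sets f X <> on_sets f Y.
Proof.
move=> dX dY dXY; rewrite !on_setsE => E.
have kS : k = k.+1 -> False by move/eqP; rewrite eqn_leq ltnn andbF.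
case: f_adj => [/(_ (Grassmannian dX) (Grassmannian dY) dXY)|[f_inj _]].
  by rewrite /adjacent E setIid => /(has_dim_uniq dot) /(_ (gr_dim _))/kS.
apply: kS; apply: (has_dim_uniq dot dXY).
by have /f_inj/(congr1 (@gr_set _ _ _))/= -> := gr_inj E; rewrite setIid.
Qed.

End Transformation.

Theorem theorem1 (R : realType) (H : completeNormedModType R[i])
    (dot : {dot H for Num.conj}) (dotE : inner_product_norm dot)
    (k : nat) (k_gt1 : (2 < 2 * k)%N) (dimH : dim_gt H (2 * k))
    (f : grassmannian H k -> grassmannian H k)
    (f_orth : {homo f : X Y / gr_orthogonal dot X Y})
    (f_adj : {homo f : X Y / adjacent X Y} \/
             injective f /\ {homo f : X Y / ortho_adjacent dot X Y}) :
  exists2 L : H -> H, is_isometry L &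
    forall X : grassmannian H k, f X = L @` X :> set H.
Proof.
case: k k_gt1 dimH f f_orth f_adj => [|[|k]]// _ dimH f f_orth f_adj.
have [s [L [[sD sM s1 sC] [LP Ln LF]]]] :=
  admissible_semilinear (admissible_on_sets f_orth f_adj) dimH
    (on_sets_separates f_adj).
have sE := complex_endo_id_or_conj sD sM s1 sC.
exists L.
  split.
    case: sE => sE; [left|right] => a x y; by rewrite LP sE.
  move=> x; apply/eqP; rewrite -(@eqrXn2 _ 2)// !dotE Ln; apply/eqP.
  by case: sE => -> //; rewrite -dotC.
move=> X; rewrite -LF.
- by rewrite (on_setsE _ (gr_dim X)); congr (gr_set (f _)); exact: gr_inj.
- by move=> a; case: sE => sE; [exists a|exists a^*]; rewrite sE// conjCK.
- exact: gr_dim.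
Qed.
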